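(* Let $d, j \in \mathbb{N}$ and let $0 < \alpha < d$. (i) Let $f$ be a probability density function on $\mathbb{R}^d$. If $r_c(f) < \alpha d/(d-\alpha)$, and also for some $k_0 \in \mathbb{N}$ we have $$ 0 < \inf_{k \ge k_0} \frac{F(A_k)}{F(A_{k-1})} \le \sup_{k \ge k_0} \frac{F(A_k)}{F(A_{k-1})} < \infty, \qquad ( * ) $$ then $\limsup_{n \to \infty} \mathbb{E}[n^{-1} S_{n,\alpha}] = \infty$. (ii) For every $r$ with $0 < r < \alpha d/(d-\alpha)$ there exists a bounded continuous probability density function $f$ on $\mathbb{R}^d$ satisfying $( * )$ for some $k_0 \in \mathbb{N}$, such that $I_{1-\alpha/d}(f) < \infty$, but with $r_c(f) = r$, so that $\limsup_{n \to \infty} \mathbb{E}[n^{-1} S_{n,\alpha}] = \infty$.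
   Context: $\mathbb{N} = \{1,2,\ldots\}$. For a finite set $\mathcal{X} \subset \mathbb{R}^d$ and $x \in \mathcal{X}$, $D(x,\mathcal{X}) = D_j(x,\mathcal{X})$ denotes the Euclidean distance from $x$ to its $j$th nearest neighbor in $\mathcal{X} \setminus \{x\}$ if $\mathrm{card}(\mathcal{X}) > j$, and $D(x,\mathcal{X}) := 0$ if $\mathrm{card}(\mathcal{X}) \le j$. Given a probability density $f$ on $\mathbb{R}^d$, $(X_i)_{i \in \mathbb{N}}$ is a sequence of independent random vectors in $\mathbb{R}^d$ with common density $f$, $\mathcal{X}_n := \{X_1,\ldots,X_n\}$, and $$S_{n,\alpha} := \sum_{i=1}^n (n^{1/d} D(X_i,\mathcal{X}_n))^{\alpha}.$$ For $\rho > 0$, $I_\rho(f) := \int_{\mathbb{R}^d} f(y)^\rho\, dy$. With $|\cdot|$ the Euclidean norm, for $r \ge 0$ let $M_r(f) := \mathbb{E}[|X_1|^r] = \int_{\mathbb{R}^d} |x|^r f(x)\, dx$, and define the critical moment $r_c(f) := \sup\{r \ge 0 : M_r(f) < \infty\} \in [0,\infty]$. For $k \in \mathbb{N}$, $A_k$ is the annular shell centered at the origin of $\mathbb{R}^d$ with inner radius $2^k$ and outer radius $2^{k+1}$, and $A_0$ is the ball centered at the origin with radius $2$. For Borel $A \subset \mathbb{R}^d$, $F(A) := P[X_1 \in A] = \int_A f(x)\, dx$. Condition $( * )$ includes that the ratios are well defined, i.e. $F(A_{k-1}) > 0$ for $k \ge k_0$. *)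

(* Defs.v *)
From HB Require Import structures.
From mathcomp Require Import all_boot all_order all_algebra finmap.
From mathcomp Require Import all_classical all_reals all_analysis.

Set Implicit Arguments.
Unset Strict Implicit.
Unset Printing Implicit Defensive.

Import Order.TTheory GRing.Theory Num.Theory.
Import numFieldNormedType.Exports.

Local Open Scope classical_set_scope.
Local Open Scope ring_scope.

(* R^d is ['rV[R]_d]; its library topology is the product topology, so [borel]
   below is the usual Borel sigma-algebra. *)

Section borel_rV.
Context {R : realType} {d : nat}.

Let borel : set (set 'rV[R]_d) := <<s (@open 'rV[R]_d) >>.

Let borel0 : borel set0.
Proof. exact: sigma_algebra0. Qed.

Let borelC A : borel A -> borel (~` A).
Proof. exact: sigma_algebraC. Qed.

Let borel_bigcup (F : (set 'rV[R]_d)^nat) :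
  (forall i, borel (F i)) -> borel (\bigcup_i F i).
Proof. exact: sigma_algebra_bigcup. Qed.

HB.instance Definition _ :=
  @isMeasurable.Build default_measure_display 'rV[R]_d
    borel borel0 borelC borel_bigcup.

End borel_rV.

Section borel_rV_theory.
Context {R : realType}.

Lemma open_measurable_rV d (U : set 'rV[R]_d) : open U -> measurable U.
Proof. by move=> oU; exact: sub_sigma_algebra. Qed.

Lemma continuous_measurable_rV d (f : 'rV[R]_d -> R) :
  continuous f -> measurable_fun setT f.
Proof.
move=> /continuousP cf; apply: (measurability _ (measurable_realfun.RGenOpens.measurableE R)).
move=> _ [_ [a [b ->] <-]]; rewrite setTI.
by apply: open_measurable_rV; apply: cf; exact: interval_open.
Qed.

Lemma measurable_coord_rV d (i : 'I_d) :
  measurable_fun setT (fun x : 'rV[R]_d => x 0 i).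
Proof. by apply: continuous_measurable_rV => x; exact: coord_continuous. Qed.

Lemma ball_rV_box d (c : 'rV[R]_d) (e : R) : 0 < e ->
  ball c e = \bigcap_(i in [set: 'I_d]) [set x : 'rV[R]_d | ball (c 0 i) e (x 0 i)].
Proof.
move=> e0; apply/seteqP; split => [x [_ h] i _ /=|x h]; first exact: h.
by split => // i j; rewrite (ord1 i); exact: h.
Qed.

Lemma measurable_fun_rVP d d' (T : measurableType d') (f : T -> 'rV[R]_d) :
  measurable_fun setT f <->
  forall i, measurable_fun setT (fun t => f t 0 i).
Proof.
split=> [mf i|mf].
  exact: (measurableT_comp (measurable_coord_rV i) mf).
pose c (p : 'rV[rat]_d * nat) : 'rV[R]_d := map_mx (@ratr R) p.1.
pose e (p : 'rV[rat]_d * nat) : R := p.2.+1%:R^-1.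
have e0 p : 0 < e p by rewrite invr_gt0.
apply: (measurability _ (erefl : measurable = <<s (@open 'rV[R]_d) >>)).
move=> _ [U oU <-]; rewrite setTI.
have -> : f @^-1` U = \bigcup_p
    if `[< ball (c p) (e p) `<=` U >] then f @^-1` ball (c p) (e p) else set0.
  apply/seteqP; split => [t Ut|t [p _]]; last first.
    by case: asboolP => // pU /pU.
  have := open_nbhs_nbhs (conj oU Ut); rewrite -nbhs_ballE => -[r /= r0 rU].
  pose n := Num.truncn (2 / r).
  have nr : 2 * n.+1%:R^-1 < r.
    by rewrite ltr_pdivrMr// mulrC -ltr_pdivrMr// truncnS_gt.
  have q_ i : {q : rat | f t 0 i - n.+1%:R^-1 < ratr q < f t 0 i + n.+1%:R^-1}.
    apply/cid; have [|q] := @rat_in_itvoo R (f t 0 i - n.+1%:R^-1) (f t 0 i + n.+1%:R^-1).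
      by rewrite ltrD2l gtrN// invr_gt0.
    by rewrite in_itv/=; exists q.
  pose p := (\row_i sval (q_ i), n) : 'rV[rat]_d * nat.
  have tp : ball (c p) (e p) (f t).
    rewrite ball_rV_box// => i _ /=; rewrite -ball_normE /ball_ /= !mxE.
    by rewrite ltr_distl; case: (q_ i).
  exists p => //=; case: asboolP => // -[] y py; apply: rU.
  apply: (le_ball (ltW nr)); rewrite mulr_natl mulr2n.
  by apply: (ball_triangle _ py); exact: ball_sym.
apply: countable_bigcupT_measurable; first exact: countableP.
move=> p; case: asboolP => // _; rewrite ball_rV_box// preimage_bigcap.
apply: fin_bigcap_measurable => // i _.
rewrite [X in measurable X](_ : _ =
  setT `&` (fun t => f t 0 i) @^-1` ball (c p 0 i) (e p)); last by rewrite setTI.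
by apply: mf => //; apply: measurable_realfun.open_measurable; exact: ball_open.
Qed.

End borel_rV_theory.

Section lebesgue_rV.
Context {R : realType}.

Definition cons_rV d (p : R * 'rV[R]_d) : 'rV[R]_d.+1 :=
  \row_i oapp (p.2 0) p.1 (unlift ord0 i).

Definition uncons_rV d (x : 'rV[R]_d.+1) : R * 'rV[R]_d :=
  (x 0 ord0, \row_i x 0 (lift ord0 i)).

Lemma cons_rVK d : cancel (@cons_rV d) (@uncons_rV d).
Proof.
move=> [a v]; rewrite /uncons_rV /cons_rV !mxE unlift_none/=; congr (_, _).
by apply/rowP => i; rewrite !mxE liftK.
Qed.

Lemma uncons_rVK d : cancel (@uncons_rV d) (@cons_rV d).
Proof.
move=> x; apply/rowP => i; rewrite mxE.
by case: unliftP => [j|] -> //=; rewrite mxE.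
Qed.

Lemma measurable_cons_rV d : measurable_fun setT (@cons_rV d).
Proof.
apply/measurable_fun_rVP => i; rewrite /cons_rV.
under eq_fun do rewrite mxE.
case: unliftP => [j _|_] /=; last exact: measurable_fst.
exact: (measurableT_comp (measurable_coord_rV j) measurable_snd).
Qed.

Lemma measurable_uncons_rV d : measurable_fun setT (@uncons_rV d).
Proof.
apply: measurable_fun_pair; first exact: measurable_coord_rV.
apply/measurable_fun_rVP => i; under eq_fun do rewrite mxE.
exact: measurable_coord_rV.
Qed.

Section step.
Variables (d : nat) (m : {sigma_finite_measure set 'rV[R]_d -> \bar R}).
Local Open Scope ereal_scope.

Definition lebesgue_rV_step : set 'rV[R]_d.+1 -> \bar R :=
  pushforward (@lebesgue_measure R \x m) (@cons_rV d).

Let step0 : lebesgue_rV_step set0 = 0.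
Proof. by rewrite /lebesgue_rV_step /pushforward preimage_set0 measure0. Qed.

Let step_ge0 A : 0 <= lebesgue_rV_step A.
Proof. exact: (measure_ge0 (@lebesgue_measure R \x m)). Qed.

Let step_sigma_additive : semi_sigma_additive lebesgue_rV_step.
Proof.
pose mu := [the measure _ _ of @lebesgue_measure R \x m].
exact: (@measure_semi_sigma_additive _ _ _
  (measure_function_pushforward__canonical__measure_function_Measure mu
    (measurable_cons_rV (d := d)))).
Qed.

HB.instance Definition _ := isMeasure.Build _ _ _ lebesgue_rV_step
  step0 step_ge0 step_sigma_additive.

Let step_sigma_finite : sigma_finite setT lebesgue_rV_step.
Proof.
have /sigma_finiteP[F [TF ndF Foo]] := sigma_finiteT (@lebesgue_measure R).
have /sigma_finiteP[G [TG ndG Goo]] := sigma_finiteT m.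
exists (fun n => @uncons_rV d @^-1` (F n `*` G n)).
  rewrite -preimage_bigcup (_ : \bigcup_i _ = setT) ?preimage_setT//.
  apply/seteqP; split => // -[x y] _.
  have [i _ Fix] : (\bigcup_i F i) x by rewrite -TF.
  have [j _ Gjy] : (\bigcup_i G i) y by rewrite -TG.
  exists (maxn i j) => //; split => /=.
    by move: x Fix; exact/subsetPset/ndF/leq_maxl.
  by move: y Gjy; exact/subsetPset/ndG/leq_maxr.
move=> n; have [[mF Fn] [mG Gn]] := (Foo n, Goo n); split.
  rewrite -[X in measurable X]setTI; apply: measurable_uncons_rV => //.
  exact: measurableX.
rewrite /lebesgue_rV_step /pushforward -comp_preimage.
rewrite (_ : _ \o _ = id) ?preimage_id; last first.
  by apply/funext => x; exact: cons_rVK.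
by rewrite product_measure1E// lte_mul_pinfty// ge0_fin_numE.
Qed.

HB.instance Definition _ := Measure_isSigmaFinite.Build _ _ _ lebesgue_rV_step
  step_sigma_finite.

End step.

(* Lebesgue measure on R^d, as the d-fold product of the one-dimensional one
   (see [lebesgue_rV_box]); R^0 is a single point, of mass 1. *)
Fixpoint lebesgue_rV d : {sigma_finite_measure set 'rV[R]_d -> \bar R} :=
  if d is d'.+1 then lebesgue_rV_step (lebesgue_rV d') else \d_(0 : 'rV[R]_0).

Lemma lebesgue_rV_box d (A : 'I_d -> set R) :
  (forall i, measurable (A i)) ->
  lebesgue_rV d [set x | forall i, A i (x 0 i)] =
  (\prod_(i < d) lebesgue_measure (A i))%E.
Proof.
elim: d A => [|d IH] A mA.
  by rewrite big_ord0 /= diracE mem_set//= => -[].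
rewrite big_ord_recl -IH//= /lebesgue_rV_step /pushforward.
rewrite -product_measure1E//.
  congr (_ _); apply/seteqP; split => -[a v] /=.
    move=> Aav; split.
      by have := Aav ord0; rewrite mxE unlift_none.
    by move=> i; have := Aav (lift ord0 i); rewrite mxE liftK.
  by move=> [Aa Av] i; rewrite mxE; case: unliftP => [j|] ->.
  exact: mA.
rewrite [X in measurable X](_ : _ = \bigcap_(i in [set: 'I_d])
    ((fun x : 'rV[R]_d => x 0 i) @^-1` A (lift ord0 i))); last first.
  by apply/seteqP; split => [x h i _|x h i]; exact: h.
apply: fin_bigcap_measurable => // i _; rewrite -[X in measurable X]setTI.
exact: measurable_coord_rV.
Qed.

End lebesgue_rV.
Arguments lebesgue_rV : clear implicits.

Section euclidean.
Context {R : realType} {d : nat}.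

(* The library norm on ['rV[R]_d] is the sup norm. *)
Definition enorm (x : 'rV[R]_d) : R := Num.sqrt (\sum_i x 0 i ^+ 2).

(* [D_j(x, X)]: the [j]-th entry (counting from 1) of the sorted list of the
   distances from [x] to the points of [X] other than [x]; equidistant
   neighbours are counted separately. *)
Definition knn_dist (j : nat) (x : 'rV[R]_d) (X : {fset 'rV[R]_d}) : R :=
  if (j < #|` X|)%N
  then nth 0 (sort <=%R [seq enorm (y - x) | y <- enum_fset (X `\ x)%fset]) j.-1
  else 0.

(* Half-open shells, so that they partition R^d. *)
Definition shell (k : nat) : set 'rV[R]_d :=
  if k is 0%N then [set x | enorm x < 2]
  else [set x | 2 ^+ k <= enorm x < 2 ^+ k.+1].

End euclidean.

Section densities.
Context {R : realType} {d : nat}.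
Implicit Type f : 'rV[R]_d -> R.
Local Notation mu := (lebesgue_rV R d).

Definition is_density f :=
  [/\ measurable_fun setT f, forall x, 0 <= f x &
      (\int[mu]_x (f x)%:E = 1)%E].

Definition I_ (rho : R) f : \bar R := (\int[mu]_x (f x `^ rho)%:E)%E.

Definition moment (r : R) f : \bar R :=
  (\int[mu]_x (enorm x `^ r * f x)%:E)%E.

Definition critical_moment f : \bar R :=
  ereal_sup [set r%:E | r in [set r : R | 0 <= r /\ (moment r f < +oo)%E]].

Definition mass f (A : set 'rV[R]_d) : R := \int[mu]_(x in A) f x.

Definition shell_ratio f (k : nat) : R :=
  mass f (shell k) / mass f (shell k.-1).

(* The positivity of the denominators is explicit because [x / 0 = 0]. *)
Definition shell_condition f (k0 : nat) :=
  let ratios := [set (shell_ratio f k)%:E | k in [set k | (k0 <= k)%N]] in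
  (forall k, (k0 <= k)%N -> 0 < mass f (shell k.-1)) /\
  (0 < ereal_inf ratios /\ ereal_inf ratios <= ereal_sup ratios /\
   ereal_sup ratios < +oo)%E.

End densities.

Section samples.
Context {R : realType} {dO : measure_display} {Omega : measurableType dO}.
Variable P : probability Omega R.

Definition mutually_independent d' (T : measurableType d')
    (X : nat -> {RV P >-> T}) :=
  forall (J : {fset nat}) (A : nat -> set T),
    (forall i, measurable (A i)) ->
    P (\bigcap_(i in [set` J]) X i @^-1` A i) =
    (\prod_(i <- J) P (X i @^-1` A i))%E.

Context {d : nat}.

Definition has_density (Y : {RV P >-> 'rV[R]_d}) (f : 'rV[R]_d -> R) :=
  forall A, measurable A ->
    distribution P Y A = (\int[lebesgue_rV R d]_(x in A) (f x)%:E)%E.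

Definition iid_with_density (X : nat -> {RV P >-> 'rV[R]_d})
    (f : 'rV[R]_d -> R) :=
  mutually_independent X /\ forall i, has_density (X i) f.

Variable X : nat -> {RV P >-> 'rV[R]_d}.

(* The sample is indexed from 0: [X 0] is the first vector. *)
Definition sample (n : nat) (w : Omega) : {fset 'rV[R]_d} :=
  [fset X (val i) w | i in 'I_n]%fset.

Definition S_ (j : nat) (alpha : R) (n : nat) (w : Omega) : R :=
  \sum_(i < n)
    (n%:R `^ d%:R^-1 * knn_dist j (X (val i) w) (sample n w)) `^ alpha.

End samples.

(* Main.v *)
Require Import Defs.
From HB Require Import structures.
From mathcomp Require Import all_boot all_order all_algebra finmap.
From mathcomp Require Import all_classical all_reals all_analysis.
From mathcomp Require Import measurable_realfun.
From mathcomp Require Import ring lra zify.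
Set Implicit Arguments.
Unset Strict Implicit.
Unset Printing Implicit Defensive.
Import Order.TTheory GRing.Theory Num.Theory.
Import numFieldNormedType.Exports.
Local Open Scope classical_set_scope.
Local Open Scope ring_scope.

(** The normalised sum is large because of isolated points. Fix a far shell
    [A_k], of mass [F_k]. Under the ratio condition the shells next to it have
    masses comparable with [F_k], so a sample of [n] points, with [n] a small
    multiple of [1 / F_k], leaves a neighbourhood of [A_k] empty with
    probability bounded below, and a given point [X_i] is the only one there
    with probability at least a multiple of [F_k]. An isolated point contributes
    at least [(n^(1/d) 2^(k-1))^alpha] to the sum, whence
    [E (S_n / n) >= c n^(alpha/d) F_k 2^(alpha k) >= c' F_k^(1-alpha/d) 2^(alpha k)].
    If the right-hand side were bounded in [k], the masses would decay like
    [2^(- beta k)] with [beta = alpha d / (d - alpha)], and all moments of order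
    less than [beta] would be finite, against the assumption on the critical
    moment. So the expectations are unbounded along a sequence of sample sizes
    that tends to infinity with [k], because [F_k] tends to 0. The main lemmas
    are [knn_dist_isolating_event], [probability_isolating_event_ge],
    [expectation_S_ge], [shell_mass_unbounded] and [limn_esup_expectation_S].

    For the second part, the mass of each shell is concentrated in a ball of
    radius 1/2: the density is proportional to a sum of disjoint spikes, the
    [k]-th one of height of order [2^(- r k)] and centred on an axis in the
    middle of [A_k]. The masses are then of order [2^(- r k)], which gives the
    ratio condition and the critical moment [r]; and since the volumes are
    bounded, the integral of any positive power of the density is dominated by
    a geometric series. Boxes inside and around the spikes give all necessary
    estimates; the normalising constant is only known to be positive and
    finite. *)

(** * Powers, limits superior and integrals *)

Lemma limn_esup_pinfty (R : realType) (u : (\bar R)^nat) :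
  (forall N (M : R), exists2 n, (N <= n)%N & (M%:E <= u n)%E) ->
  limn_esup u = +oo%E.
Proof.
move=> uoo; apply/eqP; rewrite -leye_eq /limn_esup /limf_esup.
apply: le_ereal_inf_tmp => _ [V [N _ NV] <-].
rewrite leye_eq; apply/eqP/eqyP => M _.
have [n Nn Mn] := uoo N M.
apply: (le_trans Mn); apply: ereal_sup_ubound; exists n => //.
exact: NV.
Qed.

(** Bernoulli's inequality; it holds for negative [g] as well, where it bounds
    geometric growth from below. *)
Lemma bernoulli_ineq (R : realDomainType) (g : R) n : g <= 1 ->
  1 - n%:R * g <= (1 - g) ^+ n.
Proof.
move=> g1; elim: n => [|n IH]; first by rewrite mul0r subr0 expr0.
rewrite exprS (@le_trans _ _ ((1 - g) * (1 - n%:R * g)))//; last first.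
  by rewrite ler_wpM2l// subr_ge0.
rewrite -natr1 -subr_ge0 [leRHS](_ : _ = n%:R * g ^+ 2); last by ring.
by rewrite mulr_ge0// sqr_ge0.
Qed.

Section powR.
Context {R : realType}.

Lemma powR_exprn (a s : R) n : 0 <= a -> (a ^+ n) `^ s = (a `^ s) ^+ n.
Proof.
by move=> a0; rewrite -powR_mulrn// powRAC powR_mulrn// powR_ge0.
Qed.

Lemma ler_powR2r (a b s : R) : 0 <= s -> 0 <= a -> a <= b -> a `^ s <= b `^ s.
Proof. by move=> s0 a0 ab; rewrite ge0_ler_powR// nnegrE// (le_trans a0). Qed.

Lemma powR2_gt1 (t : R) : 0 < t -> 1 < 2 `^ t.
Proof.
move=> t0; have := gt0_ltr_powR t0 (x := 1) (y := 2).
by rewrite powR1; apply; rewrite ?nnegrE// ltr1n.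
Qed.

Lemma powR2_lt1 (t : R) : t < 0 -> 2 `^ t < 1.
Proof.
move=> t0; rewrite -[t]opprK powRN invf_lt1 ?powR_gt0//.
by rewrite powR2_gt1// oppr_gt0.
Qed.

End powR.

Section nonneg_integral.
Context {dT : measure_display} {T : measurableType dT} {R : realType}.
Variable m : {measure set T -> \bar R}.

(** Monotonicity of the integral for functions that need not be measurable: the
    integral of a nonnegative function is a supremum over the simple functions
    below it. It lets the expectation of [S_] be bounded from below without
    studying the measurability of the nearest-neighbour distance. *)
Lemma ge0_le_integral_setT (f g : T -> \bar R) :
  (forall x, 0 <= f x)%E -> (forall x, f x <= g x)%E ->
  (\int[m]_x f x <= \int[m]_x g x)%E.
Proof.
move=> f0 fg; have g0 x : (0 <= g x)%E by exact: le_trans (f0 x) (fg x).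
rewrite !ge0_integralTE//; apply: le_ereal_sup => _ [h hf <-].
by exists h => // x; exact: le_trans (hf x) (fg x).
Qed.

End nonneg_integral.

(** * The Euclidean norm *)

Section enorm.
Context {R : realType} {d : nat}.
Implicit Types x y : 'rV[R]_d.

Lemma enorm_ge0 x : 0 <= enorm x.
Proof. exact: sqrtr_ge0. Qed.

Lemma sqr_enorm x : enorm x ^+ 2 = \sum_i x 0 i ^+ 2.
Proof. by rewrite sqr_sqrtr// sumr_ge0// => i _; exact: sqr_ge0. Qed.

(** Cauchy-Schwarz, from expanding the nonnegative sum of the squares of the
    coordinates of [|y|^2 x - <x, y> y]. *)
Lemma enorm_sum_mul_le x y : \sum_i x 0 i * y 0 i <= enorm x * enorm y.
Proof.
have sumE (b c : R) : \sum_i (b * x 0 i - c * y 0 i) ^+ 2 =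
    b ^+ 2 * enorm x ^+ 2 - 2 * b * c * (\sum_i x 0 i * y 0 i) +
    c ^+ 2 * enorm y ^+ 2.
  rewrite !sqr_enorm !mulr_sumr -sumrB -big_split/=.
  by apply: eq_bigr => i _; ring.
set c := \sum_i _; set a := enorm x ^+ 2; set b := enorm y ^+ 2.
have b0 : 0 <= b by exact: sqr_ge0.
have : 0 <= \sum_i (b * x 0 i - c * y 0 i) ^+ 2.
  by apply: sumr_ge0 => i _; exact: sqr_ge0.
rewrite sumE -/a -/b -/c [X in 0 <= X](_ : _ = b * (a * b - c ^+ 2)); last by ring.
have [b0' _|bn0] := eqVneq b 0.
  have y0 i : y 0 i = 0.
    apply/eqP; rewrite -sqrf_eq0; apply/eqP; move: i (erefl true).
    apply/psumr_eq0P; first by move=> i _; exact: sqr_ge0.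
    by rewrite -sqr_enorm.
  have -> : c = 0 by rewrite /c big1// => i _; rewrite y0 mulr0.
  by rewrite mulr_ge0 ?enorm_ge0.
rewrite pmulr_rge0 ?lt_def ?bn0// subr_ge0 /a /b -exprMn => h.
have h0 : 0 <= enorm x * enorm y by rewrite mulr_ge0 ?enorm_ge0.
by have [c0|/ltW c0] := leP 0 c; [rewrite -(ler_pXn2r (n := 2))|exact: le_trans c0 _].
Qed.

Lemma enormD x y : enorm (x + y) <= enorm x + enorm y.
Proof.
rewrite -(ler_pXn2r (n := 2)) ?nnegrE ?addr_ge0 ?enorm_ge0//.
rewrite sqrrD !sqr_enorm.
under eq_bigr do rewrite mxE sqrrD.
rewrite !big_split/= lerD2r lerD2l.
by rewrite mulr2n lerD ?enorm_sum_mul_le.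
Qed.

Lemma enormN x : enorm (- x) = enorm x.
Proof. by congr Num.sqrt; apply: eq_bigr => i _; rewrite mxE sqrrN. Qed.

Lemma ler_dist_enorm x y : `|enorm x - enorm y| <= enorm (x - y).
Proof.
have h (u v : 'rV[R]_d) : enorm u - enorm v <= enorm (u - v).
  by rewrite lerBlDr; have := enormD (u - v) v; rewrite subrK.
by rewrite ler_norml h andbT lerNl opprB -[leRHS]enormN opprB h.
Qed.

Lemma enorm_coord x i : `|x 0 i| <= enorm x.
Proof.
rewrite -sqrtr_sqr ler_wsqrtr// (bigD1 i)//= lerDl.
by apply: sumr_ge0 => k _; exact: sqr_ge0.
Qed.

Lemma enorm_le_coord x (e : R) : (forall i, `|x 0 i| <= e) -> 0 <= e ->
  enorm x <= d%:R * e.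
Proof.
move=> xe e0; rewrite -(ler_pXn2r (n := 2)) ?nnegrE ?mulr_ge0 ?enorm_ge0//.
rewrite sqr_enorm (@le_trans _ _ (\sum_(i < d) e ^+ 2))//.
  apply: ler_sum => i _; rewrite -real_normK ?num_real//.
  by rewrite ler_pXn2r ?nnegrE.
rewrite sumr_const card_ord -[leLHS]mulr_natl exprMn ler_wpM2r ?sqr_ge0//.
by rewrite -natrX ler_nat; case: (d) => // n; rewrite expnS expn1 leq_pmulr.
Qed.

Lemma enorm_axis (i : 'I_d) (a : R) : enorm (a *: delta_mx 0 i) = `|a|.
Proof.
rewrite /enorm (bigD1 i)//= big1 => [|k ki]; last first.
  by rewrite !mxE/= (negbTE ki) mulr0 expr0n.
by rewrite !mxE/= !eqxx mulr1 addr0 sqrtr_sqr.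
Qed.

(** The topology is that of the sup norm, so a modulus of continuity given in
    terms of [enorm] is transferred through [enorm_le_coord]. *)
Lemma continuous_enorm_lipschitz (h : 'rV[R]_d -> R) (L : R) :
  (forall x y, h x - h y <= L * enorm (x - y)) -> continuous h.
Proof.
move=> hL x; apply/(@cvgrPdist_le _ _ _ (nbhs x) (nbhs_filter x)) => e e0 /=.
have L0 : 0 < `|L| + 1 by rewrite ltr_pwDr.
have D0 : 0 < d%:R + 1 :> R by rewrite ltr_pwDr.
have r0 : 0 < e / (`|L| + 1) / (d%:R + 1) by rewrite !divr_gt0.
apply: filterS (nbhsx_ballx x _ r0) => y [_ xy].
have yx : enorm (x - y) <= e / (`|L| + 1).
  rewrite (@le_trans _ _ (d%:R * (e / (`|L| + 1) / (d%:R + 1))))//.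
    apply: enorm_le_coord (ltW r0) => i.
    by rewrite !mxE ltW//; exact: xy.
  by rewrite mulrCA ler_piMr ?ltW ?divr_gt0// ltr_pdivrMr// mul1r ltrDl.
have key u v : enorm (u - v) <= e / (`|L| + 1) -> h u - h v <= e.
  move=> uv; apply: (le_trans (hL u v)).
  rewrite (@le_trans _ _ ((`|L| + 1) * enorm (u - v)))//.
    by rewrite ler_wpM2r ?enorm_ge0// (le_trans (ler_norm L))// lerDl.
  by rewrite mulrC -ler_pdivlMr.
by rewrite ler_norml key // andbT lerNl opprB key // -enormN opprB.
Qed.

Lemma continuous_enorm : continuous (@enorm R d).
Proof.
apply: (@continuous_enorm_lipschitz _ 1) => x y.
by rewrite mul1r; exact: le_trans (ler_norm _) (ler_dist_enorm x y).
Qed.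

Lemma measurable_enorm : measurable_fun setT (@enorm R d).
Proof. by apply: continuous_measurable_rV; exact: continuous_enorm. Qed.

End enorm.

(** * Dyadic shells *)

Section shell.
Context {R : realType} {d : nat}.
Implicit Types x y : 'rV[R]_d.

Lemma measurable_enorm_lt (b : R) : measurable [set x : 'rV[R]_d | enorm x < b].
Proof.
apply: open_measurable_rV; have /continuousP := @continuous_enorm R d.
by move=> /(_ _ (@open_lt _ b)).
Qed.

Lemma measurable_enorm_itv (a b : R) :
  measurable [set x : 'rV[R]_d | a <= enorm x < b].
Proof.
rewrite [X in measurable X](_ : _ =
    [set x : 'rV[R]_d | enorm x < b] `\` [set x | enorm x < a]).
  by apply: measurableD; exact: measurable_enorm_lt.
apply/seteqP; split => x /=.
  by move=> /andP[ax xb]; split => //; apply/negP; rewrite -leNgt.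
by move=> [-> /negP]; rewrite -leNgt => ->.
Qed.

Lemma measurable_shell k : measurable (@shell R d k).
Proof. by case: k => [|k]; [exact: measurable_enorm_lt|exact: measurable_enorm_itv]. Qed.

Lemma shell_lt k x : shell k x -> enorm x < 2 ^+ k.+1.
Proof. by case: k => [|k] /=; rewrite ?expr1// => /andP[]. Qed.

Lemma shell_ge k x : (0 < k)%N -> shell k x -> 2 ^+ k <= enorm x.
Proof. by case: k => // k _ /andP[]. Qed.

Lemma in_shell k x : 2 ^+ k <= enorm x < 2 ^+ k.+1 -> shell k x.
Proof. by case: k => //= /andP[_]; rewrite expr1. Qed.

Lemma shell_inj k l x : shell k x -> shell l x -> k = l.
Proof.
wlog kl : k l / (k < l)%N.
  by move=> h xk xl; case: (ltngtP k l) => // kl; [|symmetry]; exact: h.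
move=> /shell_lt xk /(shell_ge (leq_ltn_trans (leq0n _) kl)) xl.
suff : 2 ^+ k.+1 <= 2 ^+ l :> R by move=> /(lt_le_trans xk)/lt_le_trans/(_ xl); rewrite ltxx.
by rewrite ler_eXn2l// ltr1n.
Qed.

Lemma trivIset_shell : trivIset setT (@shell R d).
Proof.
apply/trivIsetP => k l _ _ /eqP kl; apply/seteqP; split => // x [].
by move=> /shell_inj h /h.
Qed.

Lemma bigcup_shell : \bigcup_k @shell R d k = setT.
Proof.
apply/seteqP; split => // x _.
have [n xn] : exists n, enorm x < 2 ^+ n.+1.
  exists (Num.truncn (enorm x)); rewrite (lt_trans (truncnS_gt _))//.
  by rewrite -natrX ltr_nat ltn_expl.
elim: n xn => [|n IH] xn; first by exists 0%N.
have [/IH//|nx] := ltP (enorm x) (2 ^+ n.+1).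
by exists n.+1 => //=; rewrite nx.
Qed.

End shell.

Section near_shell.
Context {R : realType} {d : nat}.

(** For [k > 0], a point of [shell k] is at distance at least [2 ^+ k.-1] from
    every point outside this set; see [knn_dist_isolating_event]. *)
Definition near_shell k : set 'rV[R]_d :=
  [set x | 2 ^+ k.-1 <= enorm x < 2 ^+ k.+2].

Lemma measurable_near_shell k : measurable (near_shell k).
Proof. exact: measurable_enorm_itv. Qed.

End near_shell.

(** * Integrals over the shells *)

Section shell_integral.
Context {R : realType} {d : nat}.
Local Notation mu := (lebesgue_rV R d).

Lemma measurable_EFin (u : 'rV[R]_d -> R) D :
  measurable_fun setT u -> measurable_fun D (EFin \o u).
Proof. by move=> mu_; apply/measurable_EFinP; exact: measurable_funTS. Qed.

Lemma integral_shells (u : 'rV[R]_d -> R) :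
  measurable_fun setT u -> (forall x, 0 <= u x) ->
  (\int[mu]_x (u x)%:E = \sum_(k <oo) \int[mu]_(x in shell k) (u x)%:E)%E.
Proof.
move=> mu_ u0; rewrite -bigcup_shell ge0_integral_bigcup//.
- exact: measurable_shell.
- by rewrite bigcup_shell; exact: measurable_EFin.
- by move=> x _; rewrite lee_fin.
- exact: trivIset_shell.
Qed.

(** All finiteness statements below (moments, power integrals, total mass)
    reduce to a geometric decay of the integrals over the dyadic shells. *)
Lemma integral_lty_shells (u : 'rV[R]_d -> R) (C q : R) :
  measurable_fun setT u -> (forall x, 0 <= u x) -> 0 <= q < 1 ->
  (forall k, \int[mu]_(x in shell k) (u x)%:E <= (C * q ^+ k)%:E)%E ->
  (\int[mu]_x (u x)%:E < +oo)%E.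
Proof.
move=> mu_ u0 /andP[q0 q1] uC; rewrite integral_shells//.
have I0 k : (0 <= \int[mu]_(x in shell k) (u x)%:E)%E.
  by apply: integral_ge0 => x _; rewrite lee_fin.
have C0 : 0 <= C by have := le_trans (I0 0%N) (uC 0%N); rewrite lee_fin expr0 mulr1.
apply: (@le_lt_trans _ _ (C / (1 - q))%:E); last exact: ltry.
apply: lime_le; first exact: is_cvg_nneseries.
apply: nearW => n.
apply: (@le_trans _ _ (\sum_(0 <= k < n) (C * q ^+ k)%:E)%E).
  by apply: lee_sum => k _; exact: uC.
rewrite sumEFin lee_fin -mulr_sumr ler_wpM2l// -[leRHS]mul1r ler_pdivlMr ?subr_gt0//.
rewrite big_mkord mulrC -opprB mulNr -subrX1 opprB gerBl.
by rewrite exprn_ge0.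
Qed.

Lemma measurable_enorm_powR (s : R) : measurable_fun setT (fun x : 'rV[R]_d => enorm x `^ s).
Proof. exact: (measurableT_comp (measurable_powR s) measurable_enorm). Qed.

(** On the shell of index [k] the norm is [2 ^+ k] up to a factor 2, so moments
    are governed by the masses of the shells: here and in the next lemma. *)
Lemma integral_shell_moment_le (f : 'rV[R]_d -> R) (s : R) k :
  measurable_fun setT f -> (forall x, 0 <= f x) -> 0 <= s ->
  (\int[mu]_(x in shell k) (enorm x `^ s * f x)%:E <=
   ((2 `^ s) ^+ k.+1)%:E * \int[mu]_(x in shell k) (f x)%:E)%E.
Proof.
move=> mf f0 s0.
rewrite -ge0_integralZl_EFin//; first last.
- exact: measurable_EFin.
- by move=> x _; rewrite lee_fin.
- exact: measurable_shell.
apply: ge0_le_integral.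
- exact: measurable_shell.
- by move=> x _; rewrite lee_fin mulr_ge0// powR_ge0.
- by apply: measurable_EFin; exact: measurable_funM (measurable_enorm_powR s) mf.
- by apply: (@measurable_EFin (fun x => (2 `^ s) ^+ k.+1 * f x)); exact: measurable_funM.
- move=> x xk; rewrite lee_fin ler_wpM2r// -powR_exprn//.
  by rewrite ler_powR2r ?enorm_ge0// ltW// shell_lt.
Qed.

Lemma integral_shell_moment_ge (f : 'rV[R]_d -> R) (s : R) k :
  measurable_fun setT f -> (forall x, 0 <= f x) -> 0 <= s -> (0 < k)%N ->
  (((2 `^ s) ^+ k)%:E * \int[mu]_(x in shell k) (f x)%:E <=
  \int[mu]_(x in shell k) (enorm x `^ s * f x)%:E)%E.
Proof.
move=> mf f0 s0 k0.
rewrite -ge0_integralZl_EFin//; first last.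
- exact: measurable_EFin.
- by move=> x _; rewrite lee_fin.
- exact: measurable_shell.
apply: ge0_le_integral.
- exact: measurable_shell.
- by move=> x _; rewrite lee_fin mulr_ge0// exprn_ge0// powR_ge0.
- by apply: (@measurable_EFin (fun x => (2 `^ s) ^+ k * f x)); exact: measurable_funM.
- by apply: measurable_EFin; exact: measurable_funM (measurable_enorm_powR s) mf.
- move=> x xk; rewrite lee_fin ler_wpM2r// -powR_exprn//.
  by rewrite ler_powR2r// shell_ge.
Qed.

End shell_integral.

(** * Masses and moments *)

Section density.
Context {R : realType} {d : nat}.
Local Notation mu := (lebesgue_rV R d).
Variable f : 'rV[R]_d -> R.
Hypothesis df : is_density f.

Lemma massE (A : set 'rV[R]_d) : measurable A ->
  (\int[mu]_(x in A) (f x)%:E = (mass f A)%:E)%E.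
Proof.
case: df => mf f0 f1 mA; rewrite /mass /Rintegral fineK// ge0_fin_numE.
  apply: (@le_lt_trans _ _ (\int[mu]_x (f x)%:E)%E); last by rewrite f1 ltry.
  apply: ge0_subset_integral => //; first exact: measurable_EFin.
  by move=> x _; rewrite lee_fin.
by apply: integral_ge0 => x _; rewrite lee_fin.
Qed.

Lemma mass_ge0 (A : set 'rV[R]_d) : 0 <= mass f A.
Proof.
case: df => _ f0 _; apply: fine_ge0; apply: integral_ge0 => x _.
by rewrite lee_fin.
Qed.

Lemma le_mass (A B : set 'rV[R]_d) : measurable A -> measurable B ->
  A `<=` B -> mass f A <= mass f B.
Proof.
move=> mA mB AB; case: (df) => mf f0 f1; rewrite -lee_fin -!massE//.
apply: ge0_subset_integral => //; first exact: measurable_EFin.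
by move=> x _; rewrite lee_fin.
Qed.

Lemma mass_le1 (A : set 'rV[R]_d) : measurable A -> mass f A <= 1.
Proof.
move=> mA; rewrite -lee_fin -massE//.
case: df => mf f0 <-; apply: ge0_subset_integral => //; first exact: measurable_EFin.
by move=> x _; rewrite lee_fin.
Qed.

Lemma mass_setU (A B : set 'rV[R]_d) : measurable A -> measurable B ->
  [disjoint A & B] -> mass f (A `|` B) = mass f A + mass f B.
Proof.
move=> mA mB AB; case: (df) => mf f0 f1; apply: EFin_inj.
rewrite EFinD -!massE//; last exact: measurableU.
by apply: ge0_integral_setU => //; [exact: measurable_EFin|move=> x _; rewrite lee_fin].
Qed.

Lemma mass_setC (A : set 'rV[R]_d) : measurable A -> mass f (~` A) = 1 - mass f A.
Proof.
move=> mA; apply/eqP; rewrite eq_sym subr_eq; apply/eqP.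
rewrite -mass_setU//; [|exact: measurableC|by apply/disj_setPS => x []].
rewrite setUC setUv; apply: EFin_inj; rewrite -massE//.
by case: df.
Qed.

Lemma mass_shell_cvg0 : (fun k => mass f (shell k)) @ \oo --> 0.
Proof.
apply: cvg_series_cvg_0; apply: nondecreasing_is_cvgn.
  by apply: nondecreasing_series => n _ _; exact: mass_ge0.
exists 1 => _ [n _ <-]; rewrite /series/= -lee_fin -sumEFin.
case: (df) => mf f0 f1; rewrite -f1 integral_shells//.
rewrite (eq_bigr (fun k => \int[lebesgue_rV R d]_(x in shell k) (f x)%:E)%E).
  by apply: nneseries_lim_ge => k _ _; apply: integral_ge0 => x _; rewrite lee_fin.
by move=> k _; rewrite massE//; exact: measurable_shell.
Qed.

(** Three consecutive shells cover the neighbourhood of the middle one. *)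
Lemma mass_near_shell_le k : (0 < k)%N ->
  mass f (near_shell k) <= mass f (shell k.-1) + mass f (shell k) + mass f (shell k.+1).
Proof.
move=> k0; have mS l : measurable (@shell R d l) by exact: measurable_shell.
have disj l m : l <> m -> [disjoint @shell R d l & shell m].
  by move=> lm; apply/disj_setPS => x [xl xm]; exact/lm/(shell_inj xl xm).
rewrite -!mass_setU//; first last.
- by apply: disj; lia.
- apply/disj_setPS => x [[xl|xl] xm]; have := shell_inj xl xm; lia.
- exact: measurableU.
apply: le_mass; [exact: measurable_near_shell|by do !apply: measurableU|].
move=> x /andP[kx xk].
have [x1|x1] := ltP (enorm x) (2 ^+ k).
  by left; left; apply: in_shell; rewrite kx prednK.
have [x2|x2] := ltP (enorm x) (2 ^+ k.+1).
  by left; right; apply: in_shell; rewrite x1.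
by right; apply: in_shell; rewrite x2.
Qed.

Lemma moment_lty (C b s : R) :
  (forall k, mass f (shell k) <= C * (2 `^ (- b)) ^+ k) ->
  0 <= s -> s < b -> (moment s f < +oo)%E.
Proof.
move=> fC s0 sb; case: (df) => mf f0 f1.
apply: (@integral_lty_shells _ _ _ (C * 2 `^ s) (2 `^ (s - b))).
- exact: measurable_funM (measurable_enorm_powR s) mf.
- by move=> x; rewrite mulr_ge0// powR_ge0.
- by rewrite powR_ge0/= powR2_lt1// subr_lt0.
move=> k; apply: le_trans (integral_shell_moment_le k mf f0 s0) _.
rewrite massE; last exact: measurable_shell.
rewrite -EFinM lee_fin powRD ?pnatr_eq0 ?implybT// exprMn.
apply: le_trans (ler_wpM2l _ (fC k)) _; first by rewrite exprn_ge0// powR_ge0.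
by rewrite exprS le_eqVlt; apply/orP; left; apply/eqP; ring.
Qed.

(** Shell masses bounded by [C * 2 ^ (- b k)] make all moments of order less
    than [b] finite; so a critical moment below [b] prevents such a bound. *)
Lemma critical_moment_ge (C b : R) :
  (forall k, mass f (shell k) <= C * (2 `^ (- b)) ^+ k) ->
  (b%:E <= critical_moment f)%E.
Proof.
move=> fC; rewrite leNgt; apply/negP => cb.
have ub s : 0 <= s -> (moment s f < +oo)%E -> (s%:E <= critical_moment f)%E.
  by move=> s0 ms; apply: ereal_sup_ubound; exists s.
have c0 : (0%:E <= critical_moment f)%E.
  apply: ub => //; case: df => _ _ f1; rewrite /moment.
  by under eq_integral do rewrite powRr0 mul1r; rewrite f1 ltry.
move: (critical_moment f) ub c0 cb => [c| |] ub // c0.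
rewrite lte_fin in c0 *; rewrite lee_fin in c0 => cb.
suff : (((c + b) / 2)%:E <= c%:E)%E by rewrite lee_fin; lra.
by apply: ub; [lra|apply: (moment_lty fC); lra].
Qed.

End density.

Section shell_ratio.
Context {R : realType} {d : nat}.
Variable f : 'rV[R]_d -> R.
Local Notation F k := (mass f (shell k)).

(** The condition on the ratios as inequalities between consecutive masses,
    free of divisions and of extended reals. *)
Lemma shell_conditionP k0 : shell_condition f k0 <->
  exists c C : R, [/\ 0 < c, 0 < C & forall k, (k0 <= k)%N ->
    0 < F k.-1 /\ c * F k.-1 <= F k <= C * F k.-1].
Proof.
rewrite /shell_condition; set S := [set _ | _ in _]; split.
  move=> [F0 [infS [_ supS]]].
  have Sk k : (k0 <= k)%N -> S (shell_ratio f k)%:E by move=> kk; exists k.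
  have lb k : (k0 <= k)%N -> (ereal_inf S <= (shell_ratio f k)%:E)%E.
    by move=> /Sk; exact: ereal_inf_lbound.
  have ub k : (k0 <= k)%N -> ((shell_ratio f k)%:E <= ereal_sup S)%E.
    by move=> /Sk; exact: ereal_sup_ubound.
  move: (ereal_inf S) (ereal_sup S) infS supS lb ub => [c| |] [C| |] //= c0 _ lb ub.
  - exists c, C; split => //.
      have := lb k0 (leqnn _); have := ub k0 (leqnn _); rewrite !lee_fin lte_fin in c0 *.
      by move=> u l; apply: lt_le_trans c0 (le_trans l u).
    move=> k kk; split; first exact: F0.
    have := lb k kk; have := ub k kk; rewrite !lee_fin /shell_ratio.
    by rewrite ler_pdivrMr ?F0// ler_pdivlMr ?F0// => -> ->.
  - by have := ub k0 (leqnn _).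
  - by have := lb k0 (leqnn _).
  - by have := lb k0 (leqnn _).
move=> [c [C [c0 C0 FcC]]]; split; first by move=> k /FcC[].
have lb : (c%:E <= ereal_inf S)%E.
  apply: le_ereal_inf_tmp => _ [k /FcC[F0 /andP[cF _]] <-].
  by rewrite lee_fin /shell_ratio ler_pdivlMr.
have ub : (ereal_sup S <= C%:E)%E.
  apply: ge_ereal_sup => _ [k /FcC[F0 /andP[_ FC]] <-].
  by rewrite lee_fin /shell_ratio ler_pdivrMr.
split; first exact: lt_le_trans lb.
split; last by apply: le_lt_trans ub _; exact: ltry.
have Sk0 : S (shell_ratio f k0)%:E by exists k0 => /=.
exact: le_trans (ereal_inf_lbound Sk0) (ereal_sup_ubound Sk0).
Qed.

End shell_ratio.

(** * Isolated sample points *)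

Section knn.
Context {R : realType} {d : nat}.
Implicit Types (x y : 'rV[R]_d) (S : {fset 'rV[R]_d}).

Lemma knn_dist_ge j x S (r : R) : (0 < j)%N -> (j < #|` S|)%N -> x \in S ->
  (forall y, y \in S -> y != x -> r <= enorm (y - x)) -> r <= knn_dist j x S.
Proof.
move=> j0 jS xS rS; rewrite /knn_dist jS.
set s := sort _ _.
have js : (j.-1 < size s)%N.
  rewrite size_sort size_map prednK//.
  by move: jS; rewrite (cardfsD1 x) xS.
have := mem_nth 0 js; rewrite mem_sort => /mapP[y].
by rewrite in_fsetD1 => /andP[yx yS] ->; exact: rS.
Qed.

End knn.

Section isolated.
Context {R : realType} {d : nat} {dO : measure_display} {Omega : measurableType dO}.
Variable P : probability Omega R.
Variable f : 'rV[R]_d -> R.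
Hypothesis df : is_density f.
Variable X : nat -> {RV P >-> 'rV[R]_d}.
Hypothesis Xf : iid_with_density X f.
Variables (j k0 : nat).
Hypothesis j_gt0 : (0 < j)%N.

Lemma probability_mass l (A : set 'rV[R]_d) : measurable A ->
  P (X l @^-1` A) = (mass f A)%:E.
Proof. by move=> mA; rewrite -massE//; exact: (Xf.2 l A mA). Qed.

(** Where the [l]-th sample point must lie for [X i] to be an isolated point of
    [shell k]. The first [j] points are sent to [j] distinct fixed shells: this
    guarantees that the sample, a set, has more than [j] elements, and costs
    only a factor that does not depend on [k] nor on the sample size. All
    others, except [X i] itself, avoid the neighbourhood of [shell k]. *)
Definition isolating_region k i l : set 'rV[R]_d :=
  if (l < j)%N then shell (k0 + l)
  else if l == i then shell k else ~` near_shell k.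

Definition isolating_event n k i : set Omega :=
  \bigcap_(l in [set` [fset l | l in iota 0 n]%fset]) X l @^-1` isolating_region k i l.

Lemma measurable_isolating_region k i l : measurable (isolating_region k i l).
Proof.
rewrite /isolating_region; case: ifP => _; first exact: measurable_shell.
case: ifP => _; first exact: measurable_shell.
by apply: measurableC; exact: measurable_near_shell.
Qed.

Lemma isolating_eventP n k i w : isolating_event n k i w <->
  forall l, (l < n)%N -> isolating_region k i l (X l w).
Proof.
split=> [h l ln|h l /=]; first by apply: h; rewrite /= !inE mem_iota add0n.
by rewrite !inE mem_iota add0n => /h.
Qed.

Lemma measurable_isolating_event n k i : measurable (isolating_event n k i).
Proof.
apply: fin_bigcap_measurable; first exact: finite_fset.
move=> l _; rewrite -[X in measurable X]setTI.
by apply: measurable_funP => //; exact: measurable_isolating_region.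
Qed.

(** Independence turns the probability into a product: the fixed factor for the
    first [j] points, the mass of [shell k] for [X i], and at most [n] factors
    [1 - g], with [g] the mass of the neighbourhood of the shell, which
    Bernoulli's inequality bounds from below by [1 - n g]. *)
Lemma probability_isolating_event_ge n k i : (j <= i < n)%N ->
  (((\prod_(0 <= l < j) mass f (shell (k0 + l))) *
    (mass f (shell k) * (1 - n%:R * mass f (near_shell k))))%:E <=
  P (isolating_event n k i))%E.
Proof.
move=> /andP[ji iN]; rewrite Xf.1; last by move=> l; exact: measurable_isolating_region.
rewrite (eq_bigr (fun l => (mass f (isolating_region k i l))%:E)); last first.
  by move=> l _; rewrite probability_mass//; exact: measurable_isolating_region.
rewrite prodEFin lee_fin.
have -> : \prod_(l <- [fset l | l in iota 0 n]%fset) mass f (isolating_region k i l)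
   = \prod_(0 <= l < n) mass f (isolating_region k i l).
  apply: perm_big; apply: uniq_perm; [exact: fset_uniq|exact: iota_uniq|].
  by move=> l; rewrite !inE /index_iota subn0.
have jn : (j <= n)%N by exact: leq_trans ji (ltnW iN).
rewrite (big_cat_nat (leq0n j) jn)/=.
rewrite [X in _ <= X * _](eq_big_nat _ _ (F2 := fun l => mass f (shell (k0 + l)))); last first.
  by move=> l /andP[_ lj]; rewrite /isolating_region lj.
apply: ler_wpM2l; first by apply: prodr_ge0 => l _; exact: mass_ge0.
rewrite (bigD1_seq i)/=; [|by rewrite mem_index_iota ji|exact: iota_uniq].
rewrite {1}/isolating_region ltnNge ji/= eqxx; apply: ler_wpM2l; first exact: mass_ge0.
set g := mass f (near_shell k).
have g01 : 0 <= g <= 1 by rewrite mass_ge0// mass_le1//; exact: measurable_near_shell.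
case/andP: g01 => g0 g1; apply: (le_trans (bernoulli_ineq n g1)).
rewrite big_seq_cond (eq_bigr (fun=> 1 - g)); last first.
  move=> l /andP[]; rewrite mem_index_iota /isolating_region => /andP[jl _] li.
  by rewrite ltnNge jl/= (negbTE li) mass_setC//; exact: measurable_near_shell.
rewrite -big_seq_cond big_const_seq iter_mulr_1.
apply: ler_wiXn2l; rewrite ?subr_ge0// ?gerBl//.
by rewrite (leq_trans (count_size _ _))// size_iota leq_subr.
Qed.

(** [X i] has norm at least [2^k] and less than [2^(k+1)], the other points have
    norm less than [2^(k-1)] or at least [2^(k+2)]; the reverse triangle
    inequality separates them by [2^(k-1)]. *)
Lemma knn_dist_isolating_event n k i w : (j <= i < n)%N -> (k0 + j < k)%N ->
  isolating_event n k i w -> 2 ^+ k.-1 <= knn_dist j (X i w) (sample X n w).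
Proof.
move=> /andP[ji iN] kk /isolating_eventP Bw.
have mem l : (l < n)%N -> X l w \in sample X n w.
  by move=> ln; apply/imfsetP; exists (Ordinal ln).
have Xi : shell k (X i w).
  by have := Bw i iN; rewrite /isolating_region ltnNge ji/= eqxx.
have Xl l : (l < j)%N -> shell (k0 + l) (X l w).
  move=> lj; have := Bw l (leq_trans lj (leq_trans ji (ltnW iN))).
  by rewrite /isolating_region lj.
have jS : (j < #|` sample X n w|)%N.
  pose s := [seq X l w | l <- i :: iota 0 j].
  have <- : size s = j.+1 by rewrite size_map/= size_iota.
  apply: uniq_leq_size.
    (* [h l] is the index of the shell that contains [X l]; these are distinct
       because the fixed shells have indices less than [k0 + j < k]. *)
    pose h l := if l == i then k else (k0 + l)%N.
    have hX l : l \in i :: iota 0 j -> shell (h l) (X l w).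
      rewrite inE mem_iota add0n /h /=; case: eqVneq => [-> //|_ /= lj].
      exact: Xl.
    rewrite map_inj_in_uniq; last first.
      move=> l m ls ms lm; have := shell_inj (hX l ls); rewrite lm => /(_ _ (hX m ms)).
      move: ls ms; rewrite !inE !mem_iota /h.
      by case: (eqVneq l i) => [->|?]; case: (eqVneq m i) => [->|?] //=; lia.
    by rewrite /= iota_uniq mem_iota; lia.
  move=> y /mapP[l]; rewrite inE mem_iota => lij ->; apply: mem.
  by case/orP: lij => [/eqP ->//|]; lia.
apply: knn_dist_ge => //; first exact: mem.
move=> y /imfsetP[[l ln] _ /= ->] li.
have lNi : l != i by apply: contraNneq li => ->.
apply: (le_trans _ (ler_dist_enorm _ _)).
have k_gt0 : (0 < k)%N by lia.
have := shell_ge k_gt0 Xi; have := shell_lt Xi.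
have : enorm (X l w) < 2 ^+ k.-1 \/ 2 ^+ k.+2 <= enorm (X l w).
  have := Bw l ln; rewrite /isolating_region.
  case: ifP => [lj /shell_lt xl|_].
    left; apply: (lt_le_trans xl).
    by rewrite ler_weXn2l ?ler1n//; lia.
  rewrite (negbTE lNi) /near_shell /= => /negP; rewrite negb_and -ltNge -leNgt.
  by move=> /orP.
rewrite -[k in X in X -> _](prednK k_gt0) -[k in X in _ -> X](prednK k_gt0) !exprS.
have t0 : 0 < 2 ^+ k.-1 :> R by rewrite exprn_gt0.
move: (2 ^+ k.-1) t0 => t t0 xl xi1 xi2.
by rewrite ler_normr; case: xl => xl; apply/orP; [right|left]; lra.
Qed.

End isolated.

Section expectation_bound.
Context {R : realType} {d : nat} {dO : measure_display} {Omega : measurableType dO}.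
Variable P : probability Omega R.
Variable f : 'rV[R]_d -> R.
Hypothesis df : is_density f.
Variable X : nat -> {RV P >-> 'rV[R]_d}.
Hypothesis Xf : iid_with_density X f.
Variables (j k0 : nat) (alpha : R).
Hypotheses (j_gt0 : (0 < j)%N) (alpha_gt0 : 0 < alpha).

Lemma S_isolating_event_ge n k w : (k0 + j < k)%N -> (j <= n)%N ->
  \sum_(j <= i < n) (n%:R `^ d%:R^-1 * 2 ^+ k.-1) `^ alpha *
     \1_(isolating_event X j k0 n k i) w <= S_ X j alpha n w.
Proof.
move=> kk jn; rewrite /S_.
pose T i : R := (n%:R `^ d%:R^-1 * knn_dist j (X i w) (sample X n w)) `^ alpha.
rewrite -(big_mkord xpredT T) (big_cat_nat (leq0n j) jn)/=.
rewrite ler_wpDl ?sumr_ge0//; first by move=> i _; exact: powR_ge0.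
apply: ler_sum_nat => i jin; rewrite indicE.
case: (boolP (w \in isolating_event X j k0 n k i)) => [/set_mem iw|_]; last first.
  by rewrite mulr0 powR_ge0.
rewrite mulr1; apply: ler_powR2r; first exact: ltW.
  by rewrite mulr_ge0 ?powR_ge0// exprn_ge0.
rewrite ler_wpM2l ?powR_ge0//.
exact: (knn_dist_isolating_event j_gt0 jin kk iw).
Qed.

(** There are at least [n / 2] possible indices [i], each isolated with
    probability at least [q * F / 2], where [F] is the mass of [shell k] and [q]
    that of the fixed shells: hence the factor [4^-1]. *)
Lemma expectation_S_ge n k : (k0 + j < k)%N -> (j.*2 <= n)%N ->
  n%:R * mass f (near_shell k) <= 2^-1 ->
  ((4^-1 * (\prod_(0 <= l < j) mass f (shell (k0 + l))) * mass f (shell k) *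
     (n%:R `^ d%:R^-1 * 2 ^+ k.-1) `^ alpha)%:E <=
   'E_P[fun w => (n%:R^-1 * S_ X j alpha n w)%R])%E.
Proof.
move=> kk jjn ng.
have n0 : (0 < n)%N by lia.
have nR0 : 0 < n%:R :> R by rewrite ltr0n.
set q := \prod_(0 <= l < j) _; set c := _ `^ alpha.
have q0 : 0 <= q by apply: prodr_ge0 => l _; exact: mass_ge0.
have c0 : 0 <= c by exact: powR_ge0.
rewrite unlock.
pose h i w : \bar R := ((n%:R^-1 * c)%:E * (\1_(isolating_event X j k0 n k i) w)%:E)%E.
have h0 i w : (0 <= h i w)%E.
  by rewrite /h -EFinM lee_fin !mulr_ge0// ?invr_ge0.
have mh i : measurable_fun setT (h i).
  apply: measurable_funeM; apply/measurable_EFinP; apply: measurable_indic.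
  exact: measurable_isolating_event.
apply: (@le_trans _ _ (\int[P]_w (\sum_(j <= i < n) h i w))%E); last first.
  apply: ge0_le_integral_setT => w; first by apply: sume_ge0 => i _.
  rewrite /h; under eq_bigr do rewrite -EFinM -mulrA.
  rewrite sumEFin lee_fin -mulr_sumr ler_wpM2l ?invr_ge0//.
  by apply: S_isolating_event_ge => //; lia.
rewrite ge0_integral_sum//.
apply: (@le_trans _ _ (\sum_(j <= i < n)
    (n%:R^-1 * c * (q * (mass f (shell k) * 2^-1)))%:E)%E).
  rewrite sumEFin lee_fin sumr_const_nat -[leRHS]mulr_natl.
  have jn2 : n%:R <= 2 * (n - j)%:R :> R by rewrite -natrM ler_nat; lia.
  have F0 := mass_ge0 df (shell k).
  move: (n - j)%:R jn2 => nj jn2.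
  rewrite [leRHS](_ : _ =
      (2 * nj / n%:R) * (4^-1 * q * mass f (shell k) * c)); last first.
    by field; rewrite gt_eqF.
  by rewrite ler_peMl ?mulr_ge0// ler_pdivlMr// mul1r.
rewrite big_nat_cond [leRHS]big_nat_cond; apply: lee_sum => i /andP[jin _].
rewrite /h ge0_integralZl_EFin//; first last.
- by rewrite mulr_ge0// invr_ge0.
- apply/measurable_EFinP; apply: measurable_indic.
  exact: measurable_isolating_event.
rewrite integral_indic//; last exact: measurable_isolating_event.
rewrite setIT EFinM lee_wpmul2l// ?lee_fin ?mulr_ge0 ?invr_ge0//.
apply: le_trans (probability_isolating_event_ge df Xf k0 k jin).
rewrite lee_fin ler_wpM2l// ler_wpM2l ?mass_ge0//; lra.
Qed.

End expectation_bound.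

(** * Divergence below the critical exponent *)

Section critical.
Context {R : realType} {d : nat}.
Variables (f : 'rV[R]_d -> R) (alpha : R).
Hypotheses (df : is_density f) (alpha_gt0 : 0 < alpha) (alpha_ltd : alpha < d%:R).
Hypothesis rc : (critical_moment f < (alpha * d%:R / (d%:R - alpha))%:E)%E.
Local Notation F k := (mass f (shell k)).

(** If the product were bounded by [M] for large [k], then the masses would be
    at most a multiple of [2 ^ (- beta k)], with
    [beta = alpha / (1 - alpha / d) = alpha d / (d - alpha)], and the critical
    moment would be at least [beta]. *)
Lemma shell_mass_unbounded (N : nat) (M : R) : exists2 k, (N <= k)%N &
  M <= F k `^ (1 - alpha / d%:R) * (2 `^ alpha) ^+ k.
Proof.
have d0 : 0 < d%:R :> R by exact: lt_trans alpha_ltd.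
apply/not_exists2P => small.
have := rc; set beta := alpha * d%:R / (d%:R - alpha) => rcb.
set rho := 1 - alpha / d%:R in small *.
have rho0 : 0 < rho by rewrite subr_gt0 ltr_pdivrMr// mul1r.
have betaE : alpha / rho = beta.
  by rewrite /rho /beta; field; rewrite !gt_eqF//= subr_gt0.
(* The second summand takes care of the finitely many [k < N], for which the
   mass is only known to be at most 1. *)
suff /(critical_moment_ge df) : forall k, F k <=
    (`|M| `^ rho^-1 + (2 `^ beta) ^+ N) * (2 `^ (- beta)) ^+ k.
  by rewrite leNgt rcb.
move=> k; have b0 : 0 < 2 `^ beta :> R by exact: powR_gt0.
have beta0 : 0 < beta by rewrite /beta divr_gt0 ?mulr_gt0// subr_gt0.
rewrite mulrDl powRN; have [kN|Nk] := ltnP k N.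
  rewrite ler_wpDl ?mulr_ge0 ?powR_ge0 ?exprn_ge0 ?invr_ge0//.
  apply: (le_trans (mass_le1 df (@measurable_shell R d k))).
  rewrite exprVn ler_pdivlMr; last exact: exprn_gt0.
  rewrite mul1r; apply: ler_weXn2l; last exact: ltnW.
  by rewrite ltW// powR2_gt1.
rewrite ler_wpDr ?mulr_ge0 ?exprn_ge0 ?invr_ge0 ?powR_ge0//.
have F0 := mass_ge0 df (@shell R d k).
have FM : F k `^ rho <= `|M| * (2 `^ (- alpha)) ^+ k.
  rewrite powRN exprVn ler_pdivlMr ?exprn_gt0 ?powR_gt0//.
  have [//|/negP] := small k.
  by rewrite -ltNge => /ltW/le_trans; apply; exact: ler_norm.
rewrite (_ : F k = (F k `^ rho) `^ rho^-1); last first.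
  by rewrite -powRrM divff ?gt_eqF// powRr1.
have ri0 : 0 <= rho^-1 by rewrite invr_ge0 ltW.
apply: le_trans (ler_powR2r ri0 (powR_ge0 _ _) FM) _.
rewrite powRM// ?exprn_ge0 ?powR_ge0//.
by rewrite powR_exprn ?powR_ge0// -powRrM mulNr betaE powRN.
Qed.

Variables (dO : measure_display) (Omega : measurableType dO).
Variables (P : probability Omega R) (X : nat -> {RV P >-> 'rV[R]_d}).
Hypothesis Xf : iid_with_density X f.
Variables (j k0 : nat).
Hypotheses (j_gt0 : (0 < j)%N) (k0_gt0 : (0 < k0)%N) (fk0 : shell_condition f k0).

(** The sample size is chosen as [n], the integer part of [1 / (2 K F)], where
    [F] is the mass of [shell k] and [K F] bounds the mass of its neighbourhood:
    then the points of the neighbourhood are missed with probability at least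
    1/2, while [n] is of order [1 / F]. The lower bound of [expectation_S_ge]
    becomes a constant times [F ^ (1 - alpha / d) * 2 ^ (alpha k)], which is
    large for suitable [k] by [shell_mass_unbounded]. *)
Lemma limn_esup_expectation_S :
  limn_esup (fun n => ('E_P[fun w => (n%:R^-1 * S_ X j alpha n w)%R])%E) = +oo%E.
Proof.
have d0 : 0 < d%:R :> R by exact: lt_trans alpha_ltd.
have [c [C [c0 C0 FcC]]] := (shell_conditionP f k0).1 fk0.
have F0 k : (k0 <= k)%N -> 0 < F k.
  by move=> kk; have [] := FcC k.+1 (leqW kk).
pose K := c^-1 + 1 + C.
have K0 : 0 < K by rewrite /K !addr_gt0// invr_gt0.
have near_le k : (k0 <= k)%N -> mass f (near_shell k) <= K * F k.
  move=> kk; apply: le_trans (mass_near_shell_le df (leq_trans k0_gt0 kk)) _.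
  have [_ /andP[cF _]] := FcC k kk; have [_ /andP[_ FC]] := FcC k.+1 (leqW kk).
  by rewrite /K !mulrDl mul1r !lerD// ler_pdivlMl.
pose q := \prod_(0 <= l < j) F (k0 + l).
have q0 : 0 < q by apply: prodr_gt0 => l _; apply: F0; exact: leq_addr.
pose rho := alpha / d%:R.
pose c1 := 4^-1 * q * (4 * K) `^ (- rho) / 2 `^ alpha.
have c10 : 0 < c1 by rewrite /c1 !mulr_gt0 ?invr_gt0 ?powR_gt0 ?mulr_gt0.
apply: limn_esup_pinfty => N M.
(* [k] is taken so large that the mass of [shell k] forces [n >= n0]. *)
pose n0 := (maxn N j.*2).+1.
have eps0 : 0 < (2 * K * n0%:R)^-1 by rewrite invr_gt0 !mulr_gt0// ltr0n.
have /cvgrPdist_le/(_ _ eps0)[k1 _ k1F] := mass_shell_cvg0 df.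
have [k kk Mk] := shell_mass_unbounded (maxn k1 (k0 + j).+1) (M / c1).
have k1k : (k1 <= k)%N by rewrite (leq_trans (leq_maxl _ _) kk).
have k0k : (k0 + j < k)%N by rewrite (leq_trans (leq_maxr _ _) kk).
have k0k' : (k0 <= k)%N by exact: leq_trans (leq_addr _ _) (ltnW k0k).
have Fk0 : 0 < F k by exact: F0.
pose y := (2 * K * F k)^-1.
have y0 : 0 < y by rewrite invr_gt0 !mulr_gt0.
have n0y : n0%:R <= y.
  have := k1F k k1k; rewrite sub0r normrN gtr0_norm// => Fe.
  rewrite -[n0%:R]invrK /y lef_pV2 ?posrE ?invr_gt0 ?mulr_gt0 ?ltr0n//.
  rewrite -ler_pdivlMl ?mulr_gt0//; apply: le_trans Fe _.
  by rewrite invfM.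
have [n [n0n ny yn]] : exists n : nat, [/\ (n0 <= n)%N, n%:R <= y & y < n.+1%:R].
  exists (Num.truncn y); have /andP[? ?] := truncn_itv (ltW y0).
  by split=> //; rewrite truncn_ge_nat// ltW.
have y2n : y / 2 <= n%:R.
  rewrite ler_pdivrMr//; apply: (le_trans (ltW yn)).
  have n1 : (0 < n)%N by exact: leq_trans n0n.
  by rewrite mulr_natr mulr2n -natr1 lerD2l ler1n.
exists n; first by rewrite (leq_trans _ n0n)// ltnW// ltnS leq_maxl.
apply: (@le_trans _ _ (c1 * (F k `^ (1 - rho) * (2 `^ alpha) ^+ k))%:E).
  by rewrite lee_fin mulrC -ler_pdivrMr.
apply: le_trans (expectation_S_ge df Xf (k0 := k0) j_gt0 alpha_gt0 k0k _ _); first last.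
- apply: (@le_trans _ _ (y * (K * F k))).
    by apply: ler_pM; [exact: ler0n|exact: mass_ge0|exact: ny|exact: near_le].
  by rewrite /y le_eqVlt; apply/orP; left; apply/eqP; field; rewrite !gt_eqF.
- by rewrite (leq_trans _ n0n)// ltnW// ltnS leq_maxr.
rewrite lee_fin -/q powRM ?exprn_ge0 ?powR_ge0// -powRrM [d%:R^-1 * _]mulrC -/rho powR_exprn//.
rewrite /c1 powRB; last by rewrite (lt0r_neq0 Fk0) implybT.
rewrite powRr1 ?(ltW Fk0)//.
have -> : 4^-1 * q * (4 * K) `^ (- rho) / 2 `^ alpha * (F k / F k `^ rho * 2 `^ alpha ^+ k)
  = 4^-1 * q * F k * ((y / 2) `^ rho * 2 `^ alpha ^+ k.-1).
  have -> : (y / 2) `^ rho = (4 * K) `^ (- rho) * F k `^ (- rho).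
    have K4 : 0 < 4 * K by rewrite mulr_gt0.
    have -> : y / 2 = (4 * K * F k)^-1 by rewrite /y; field; rewrite !gt_eqF.
    by rewrite -powR_inv1 ?mulr_ge0 ?ltW// -powRrM mulN1r powRM ?ltW.
  rewrite [F k `^ (- _)]powRN.
  have -> : 2 `^ alpha ^+ k = 2 `^ alpha * 2 `^ alpha ^+ k.-1.
    by rewrite -exprS prednK//; exact: leq_ltn_trans k0k.
  have cancel (p K' a Fk Fr b : R) : 0 < a -> 0 < Fr ->
      p * K' / a * (Fk / Fr * (a * b)) = p * Fk * (K' * Fr^-1 * b).
    by move=> a_gt0 Fr_gt0; field; rewrite !gt_eqF.
  by apply: cancel; exact: powR_gt0.
apply: ler_wpM2l; first by rewrite !mulr_ge0// ltW.
apply: ler_wpM2r; first by rewrite exprn_ge0// powR_ge0.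
by apply: ler_powR2r => //; rewrite divr_ge0// ltW.
Qed.

End critical.

(** * Boxes *)

Section box.
Context {R : realType} {d : nat}.
Local Notation mu := (lebesgue_rV R d).

Definition box (c : 'rV[R]_d) (e : R) : set 'rV[R]_d :=
  [set x | forall i, c 0 i - e <= x 0 i <= c 0 i + e].

Lemma measurable_box c e : measurable (box c e).
Proof.
rewrite [X in measurable X](_ : _ = \bigcap_(i in [set: 'I_d])
    ((fun x : 'rV[R]_d => x 0 i) @^-1` `[c 0 i - e, c 0 i + e]%classic)); last first.
  apply/seteqP; split => [x h i _ /=|x h i]; first by rewrite in_itv/=; exact: h.
  by have := h i Logic.I; rewrite /= in_itv.
apply: fin_bigcap_measurable => // i _; rewrite -[X in measurable X]setTI.
exact: measurable_coord_rV.
Qed.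

Lemma lebesgue_box c e : 0 <= e -> mu (box c e) = ((2 * e) ^+ d)%:E.
Proof.
move=> e0.
have -> : box c e = [set x : 'rV[R]_d | forall i,
    `[c 0 i - e, c 0 i + e]%classic (x 0 i)].
  by apply/seteqP; split => x h i; have := h i; rewrite /= in_itv.
rewrite (@lebesgue_rV_box _ _ (fun i => `[c 0 i - e, c 0 i + e]%classic)) => [|i//].
rewrite (eq_bigr (fun=> (2 * e)%:E)).
  by rewrite prodEFin prodr_const card_ord.
move=> i _; rewrite lebesgue_measure_itv/= lte_fin.
have [_|] := ltP (c 0 i - e) (c 0 i + e); first by rewrite -EFinB; congr EFin; ring.
by move=> h; congr EFin; lra.
Qed.

Lemma boxP c e x : box c e x <-> forall i, `|(x - c) 0 i| <= e.
Proof. by split=> h i; have := h i; rewrite !mxE ler_distl. Qed.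

(** With the next lemma, two-sided estimates of the integral over a shell of a
    function concentrated on a box: only volumes of boxes are needed, never an
    exact integral. *)
Lemma integral_shell_le (u : 'rV[R]_d -> R) k c e C :
  measurable_fun setT u -> (forall x, 0 <= u x) -> 0 <= e -> 0 <= C ->
  (forall x, shell k x -> ~ box c e x -> u x = 0) ->
  (forall x, shell k x -> u x <= C) ->
  (\int[mu]_(x in shell k) (u x)%:E <= (C * (2 * e) ^+ d)%:E)%E.
Proof.
move=> mu_ u0 e0 C0 ubox uC.
have mS := @measurable_shell R d k; have mB := measurable_box c e.
have mSB : measurable (shell k `&` box c e) by exact: measurableI.
have -> : (\int[mu]_(x in shell k) (u x)%:E = \int[mu]_(x in shell k `&` box c e) (u x)%:E)%E.
  rewrite integral_mkcondr; apply: eq_integral => x /set_mem xk.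
  rewrite patchE; case: ifPn => // /negP xb; rewrite ubox// => bx; apply: xb.
  exact: mem_set.
apply: (@le_trans _ _ (C%:E * mu (shell k `&` box c e))%E).
  rewrite -integral_cst//; apply: ge0_le_integral => //.
  - by move=> x _; rewrite lee_fin.
  - exact: measurable_EFin.
  - by move=> x [xk _]; rewrite lee_fin uC.
rewrite EFinM -(lebesgue_box c e0) lee_wpmul2l ?lee_fin// le_measure ?inE//.
Qed.

Lemma integral_shell_ge (u : 'rV[R]_d -> R) k c e C :
  measurable_fun setT u -> (forall x, 0 <= u x) -> 0 <= e -> 0 <= C ->
  box c e `<=` shell k -> (forall x, box c e x -> C <= u x) ->
  ((C * (2 * e) ^+ d)%:E <= \int[mu]_(x in shell k) (u x)%:E)%E.
Proof.
move=> mu_ u0 e0 C0 bs uC.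
have mS := @measurable_shell R d k; have mB := measurable_box c e.
apply: (@le_trans _ _ (\int[mu]_(x in box c e) (u x)%:E)%E); last first.
  apply: ge0_subset_integral => //; first exact: measurable_EFin.
  by move=> x _; rewrite lee_fin.
rewrite EFinM -(lebesgue_box c e0) -integral_cst//; apply: ge0_le_integral => //.
exact: measurable_EFin.
Qed.

End box.

(** * A density made of spikes *)

Section spikes.
Context {R : realType} {d : nat}.
Variables (i0 : 'I_d) (r : R).
Hypothesis r_gt0 : 0 < r.
Local Notation mu := (lebesgue_rV R d).

Let q : R := 2 `^ (- r).

Let q_gt0 : 0 < q. Proof. exact: powR_gt0. Qed.

Let q_lt1 : q < 1. Proof. by rewrite powR2_lt1// oppr_lt0. Qed.

(** The norm of the centre is halfway between [2 ^+ k] and [2 ^+ k.+1], so that a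
    spike of radius 1/2 fits into its shell, even for [k = 0]. *)
Definition spike_center k : 'rV[R]_d := (3 / 2 * 2 ^+ k) *: delta_mx 0 i0.

Definition spike k (x : 'rV[R]_d) : R :=
  (2 `^ (- r)) ^+ k * Num.max 0 (2^-1 - enorm (x - spike_center k)).

Lemma shell_index_ex (x : 'rV[R]_d) : exists k, shell k x.
Proof. by have : [set: 'rV[R]_d] x by []; rewrite -bigcup_shell => -[k _ xk]; exists k. Qed.

(** The sum of all spikes. Their supports lie in different shells, so at [x] only
    the spike of the shell of [x] can contribute. *)
Definition spikes (x : 'rV[R]_d) : R := spike (sval (cid (shell_index_ex x))) x.

Lemma spikes_shell k x : shell k x -> spikes x = spike k x.
Proof. by rewrite /spikes; case: cid => l /= xl /(shell_inj xl) ->. Qed.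

Lemma spike_ge0 k x : 0 <= spike k x.
Proof. by rewrite mulr_ge0 ?exprn_ge0 ?powR_ge0// le_max lexx. Qed.

Lemma spikes_ge0 x : 0 <= spikes x.
Proof. exact: spike_ge0. Qed.

Lemma spike_near k x : enorm (x - spike_center k) < 2^-1 -> shell k x.
Proof.
move=> xk; apply: in_shell.
have := le_lt_trans (ler_dist_enorm _ _) xk.
rewrite enorm_axis (ger0_norm (x := 3 / 2 * _)) ?mulr_ge0 ?exprn_ge0// exprS ltr_distl.
have : 1 <= 2 ^+ k :> R by rewrite exprn_ege1// ler1n.
by move: (2 ^+ k) => t t1 /andP[xl xr]; apply/andP; split; lra.
Qed.

Lemma spike_le k x : spike k x <= q ^+ k.
Proof.
rewrite /spike ler_piMr ?exprn_ge0 ?powR_ge0// ge_max ler01/=.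
by have := enorm_ge0 (x - spike_center k); lra.
Qed.

Lemma spike_outside k x : 2^-1 <= enorm (x - spike_center k) -> spike k x = 0.
Proof. by move=> h; rewrite /spike max_l ?mulr0// subr_le0. Qed.

Lemma spike_le_spikes k x : spike k x <= spikes x.
Proof.
have [/spike_near/spikes_shell-> //|/spike_outside ->] :=
  ltP (enorm (x - spike_center k)) 2^-1.
exact: spikes_ge0.
Qed.

(** Each spike is 1-Lipschitz and at most [spikes], with equality at [x] for the
    spike of the shell of [x]; comparing that spike at [x] and [y] is enough. *)
Lemma spikes_lipschitz x y : spikes x - spikes y <= enorm (x - y).
Proof.
have [k xk] := shell_index_ex x; rewrite (spikes_shell xk).
apply: (@le_trans _ _ (spike k x - spike k y)); first by rewrite lerB// spike_le_spikes.
rewrite /spike -mulrBr; set D := _ - _.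
have qk : 0 <= q ^+ k <= 1.
  by rewrite exprn_ge0 ?exprn_ile1// ltW.
have DE : D <= enorm (x - y).
  have := enorm_ge0 (x - y).
  have := enormD (y - x) (x - spike_center k).
  rewrite -(enormN (y - x)) opprB addrA subrK /D.
  move: (enorm _) (enorm _) (enorm _) => b e a ab e0.
  by rewrite lerBlDr ge_max; have [h|h] := leP 0 (2^-1 - a); apply/andP; split; lra.
have [D0|/ltW D0] := leP 0 D.
  by apply: le_trans DE; case/andP: qk => _ qk; rewrite ler_piMl.
apply: (@le_trans _ _ 0); last exact: enorm_ge0.
by case/andP: qk => qk _; rewrite mulr_ge0_le0.
Qed.

Lemma measurable_spikes : measurable_fun setT spikes.
Proof.
apply: continuous_measurable_rV; apply: (continuous_enorm_lipschitz (L := 1)) => x y.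
by rewrite mul1r; exact: spikes_lipschitz.
Qed.

Lemma spikes_outside_box k x : shell k x -> ~ box (spike_center k) 2^-1 x ->
  spikes x = 0.
Proof.
move=> xk xb; rewrite (spikes_shell xk) spike_outside// leNgt.
apply/negP => h; apply: xb; apply/boxP => i.
by rewrite (le_trans (enorm_coord _ _))// ltW.
Qed.

(** A box of half-side [1 / (4 d)] lies in the ball of radius 1/4, where the
    spike has at least half of its maximal height. *)
Lemma small_box_near k x : box (spike_center k) (4 * d%:R)^-1 x ->
  enorm (x - spike_center k) <= 4^-1.
Proof.
have d0 : 0 < d%:R :> R by rewrite ltr0n (leq_ltn_trans _ (ltn_ord i0)).
move=> /boxP xb; apply: (le_trans (enorm_le_coord xb _)).
  by rewrite invr_ge0 mulr_ge0// ltW.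
by rewrite invfM mulrCA divff ?mulr1// gt_eqF.
Qed.

Lemma spikes_small_box k x : box (spike_center k) (4 * d%:R)^-1 x ->
  shell k x /\ 4^-1 * q ^+ k <= spikes x.
Proof.
move=> /small_box_near xb; have xk : shell k x by apply: spike_near; lra.
split => //; rewrite (spikes_shell xk) mulrC ler_wpM2l ?exprn_ge0 ?powR_ge0//.
by rewrite le_max; apply/orP; right; lra.
Qed.

Lemma integral_scaled_spikes_le (h : R -> R) k C : measurable_fun setT h ->
  (forall t, 0 <= t -> 0 <= h t) -> h 0 = 0 -> (forall t, 0 <= t <= q ^+ k -> h t <= C) ->
  (\int[mu]_(x in shell k) (h (spikes x))%:E <= C%:E)%E.
Proof.
move=> mh h0 h00 hC.
have C0 : 0 <= C by rewrite -h00; apply: hC; rewrite lexx exprn_ge0// ltW.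
have -> : C = C * (2 * 2^-1) ^+ d by rewrite divff ?expr1n ?mulr1.
apply: (@integral_shell_le _ _ _ _ (spike_center k)) => //.
- exact: measurableT_comp mh measurable_spikes.
- by move=> x; exact/h0/spikes_ge0.
- by move=> x xk xb; rewrite (spikes_outside_box xk).
- move=> x xk; apply: hC; rewrite spikes_ge0/= (spikes_shell xk).
  exact: spike_le.
Qed.

Lemma integral_scaled_spikes_ge (a : R) k : 0 <= a ->
  ((a * (4^-1 * (2 * (4 * d%:R)^-1) ^+ d) * q ^+ k)%:E <=
   \int[mu]_(x in shell k) (a * spikes x)%:E)%E.
Proof.
move=> a0.
rewrite [X in X%:E](_ : _ = a * (4^-1 * q ^+ k) * (2 * (4 * d%:R)^-1) ^+ d); last by ring.
apply: (@integral_shell_ge _ _ _ _ (spike_center k)) => //.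
- by apply: measurable_funM => //; exact: measurable_spikes.
- by move=> x; rewrite mulr_ge0// spikes_ge0.
- by rewrite !mulr_ge0// exprn_ge0// ltW.
- by move=> x /spikes_small_box[].
- by move=> x /spikes_small_box[_ h]; rewrite ler_wpM2l.
Qed.

End spikes.

Section spike_density.
Context {R : realType} {d : nat}.
Variables (i0 : 'I_d) (r : R).
Hypothesis r_gt0 : 0 < r.
Local Notation mu := (lebesgue_rV R d).
Local Notation g := (spikes i0 r).

Let q : R := 2 `^ (- r).

Let q_gt0 : 0 < q. Proof. exact: powR_gt0. Qed.

Let q_lt1 : q < 1. Proof. by rewrite powR2_lt1// oppr_lt0. Qed.

(** A lower bound for the integral of a spike of unit scale. *)
Let v : R := 4^-1 * (2 * (4 * d%:R)^-1) ^+ d.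

Let v_gt0 : 0 < v.
Proof.
have d0 : 0 < d%:R :> R by rewrite ltr0n (leq_ltn_trans _ (ltn_ord i0)).
by rewrite mulr_gt0// exprn_gt0// mulr_gt0// invr_gt0 mulr_gt0.
Qed.

Let mg : measurable_fun setT g. Proof. exact: measurable_spikes. Qed.

Let g_ge0 x : 0 <= g x. Proof. exact: spikes_ge0. Qed.

Definition spikes_total : R := fine (\int[mu]_x (g x)%:E).

Local Notation Z := spikes_total.

Lemma integral_spikes_lty : (\int[mu]_x (g x)%:E < +oo)%E.
Proof.
apply: (@integral_lty_shells _ _ _ 1 q); rewrite ?q_lt1 ?ltW// => k.
rewrite mul1r.
apply: (@integral_scaled_spikes_le _ _ i0 r r_gt0 id) => // t /andP[_].
exact.
Qed.

Lemma integral_spikes : (\int[mu]_x (g x)%:E = Z%:E)%E.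
Proof.
rewrite fineK// ge0_fin_numE ?integral_spikes_lty//.
by apply: integral_ge0 => x _; rewrite lee_fin.
Qed.

Lemma spikes_total_gt0 : 0 < Z.
Proof.
rewrite -lte_fin -integral_spikes.
apply: (@lt_le_trans _ _ (\int[mu]_(x in shell 0) (g x)%:E)%E); last first.
  apply: ge0_subset_integral => //; first exact: measurable_shell.
    exact: measurable_EFin.
  by move=> x _; rewrite lee_fin.
have := @integral_scaled_spikes_ge R d i0 r r_gt0 1 0%N ler01.
under eq_integral do rewrite mul1r.
by apply: lt_le_trans; rewrite lte_fin expr0 mulr1 mul1r.
Qed.

Let Z_gt0 := spikes_total_gt0.

Definition spike_density (x : 'rV[R]_d) : R := Z^-1 * g x.

Local Notation f := spike_density.

Lemma spike_density_is_density : is_density f.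
Proof.
split.
- exact: measurable_funM.
- by move=> x; rewrite mulr_ge0// invr_ge0 ltW.
- rewrite /spike_density; under eq_integral do rewrite EFinM.
  rewrite ge0_integralZl_EFin//; last 3 first.
  + by move=> x _; rewrite lee_fin.
  + exact: measurable_EFin.
  + by rewrite invr_ge0 ltW.
  by rewrite integral_spikes -EFinM mulVf// gt_eqF.
Qed.

Lemma spike_density_continuous : continuous f.
Proof.
apply: (continuous_enorm_lipschitz (L := Z^-1)) => x y.
by rewrite /spike_density -mulrBr ler_wpM2l ?invr_ge0 ?(ltW Z_gt0)// spikes_lipschitz.
Qed.

Lemma spike_density_bounded : bounded_fun f.
Proof.
exists Z^-1; split; first exact: num_real.
have Zi : 0 <= Z^-1 by rewrite invr_ge0 ltW.
move=> M ZM x _ /=; rewrite ger0_norm; last exact: mulr_ge0 Zi (g_ge0 x).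
apply: le_trans (ltW ZM); apply: ler_piMr => //.
have [k xk] := shell_index_ex x; rewrite (spikes_shell _ _ xk).
apply: le_trans (spike_le _ _ _ _) _.
by rewrite exprn_ile1// ltW.
Qed.

Lemma spike_density_shell_le k : mass f (shell k) <= Z^-1 * q ^+ k.
Proof.
rewrite -lee_fin -massE; [|exact: spike_density_is_density|exact: measurable_shell].
apply: (@integral_scaled_spikes_le _ _ i0 r r_gt0 (fun t => Z^-1 * t)).
- exact: measurable_funM.
- by move=> t t0; rewrite mulr_ge0// invr_ge0 ltW.
- by rewrite mulr0.
- by move=> t /andP[_ tq]; rewrite ler_wpM2l// invr_ge0 ltW.
Qed.

Lemma spike_density_shell_ge k : Z^-1 * v * q ^+ k <= mass f (shell k).
Proof.
rewrite -lee_fin -massE; [|exact: spike_density_is_density|exact: measurable_shell].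
by apply: (integral_scaled_spikes_ge i0 r_gt0); rewrite invr_ge0 ltW.
Qed.

Lemma spike_density_shell_condition : shell_condition f 1.
Proof.
apply/shell_conditionP; exists (v * q), (v^-1 * q).
have Zi : 0 < Z^-1 by rewrite invr_gt0.
split; [by rewrite mulr_gt0|by rewrite mulr_gt0 ?invr_gt0|case=> // k _ /=].
have lk := spike_density_shell_le k; have gk := spike_density_shell_ge k.
have lk1 := spike_density_shell_le k.+1; have gk1 := spike_density_shell_ge k.+1.
have Fk : 0 < mass f (shell k).
  apply: lt_le_trans _ gk; apply: mulr_gt0; [exact: mulr_gt0|exact: exprn_gt0].
split=> //; apply/andP; split.
  apply: le_trans _ gk1; rewrite exprS.
  rewrite [leRHS](_ : _ = v * q * (Z^-1 * q ^+ k)); last by ring.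
  by rewrite ler_wpM2l// mulr_ge0// ltW.
apply: (le_trans lk1); rewrite exprS.
rewrite [leLHS](_ : _ = v^-1 * q * (Z^-1 * v * q ^+ k)); last by field; rewrite !gt_eqF.
by rewrite ler_wpM2l// mulr_ge0// ?invr_ge0 ltW.
Qed.

(** Spikes have bounded volume and geometrically decreasing heights, so every
    positive power of the density is integrable. A radial density with the same
    shell masses spreads over whole shells, and its power [rho] is not integrable
    when [r rho <= d (1 - rho)]. *)
Lemma spike_density_I_lty (rho : R) : 0 < rho -> (I_ rho f < +oo)%E.
Proof.
move=> rho0; have [mf f0 _] := spike_density_is_density.
have q'01 : 0 <= q `^ rho < 1.
  rewrite powR_ge0/= /q -powRrM powR2_lt1// mulNr oppr_lt0 mulr_gt0//.
apply: (@integral_lty_shells _ _ _ (Z^-1 `^ rho) (q `^ rho)) => //.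
- exact: (measurableT_comp (measurable_powR rho) mf).
- by move=> x; exact: powR_ge0.
move=> k.
apply: (@integral_scaled_spikes_le _ _ i0 r r_gt0 (fun t => (Z^-1 * t) `^ rho)).
- by apply: (measurableT_comp (measurable_powR rho)); exact: measurable_funM.
- by move=> t _; exact: powR_ge0.
- by rewrite mulr0 powR0// gt_eqF.
move=> t /andP[t0 tq]; have Zi : 0 <= Z^-1 by rewrite invr_ge0 ltW.
rewrite powRM// ler_wpM2l ?powR_ge0// -powR_exprn ?(ltW q_gt0)//.
by apply: ler_powR2r => //; exact: ltW.
Qed.

(** The moment of order [s] is at least a constant times [2 ^ ((s - r) k)] for
    every [k], and for [s < r] it is at most a convergent geometric series. *)
Lemma spike_density_critical_moment : critical_moment f = r%:E.
Proof.
apply/eqP; rewrite eq_le; apply/andP; split; last first.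
  exact: (critical_moment_ge spike_density_is_density spike_density_shell_le).
have [mf f0 f1] := spike_density_is_density.
apply: ge_ereal_sup => _ [s [s0 ms] <-]; rewrite lee_fin leNgt; apply/negP => rs.
have m0 : (0 <= moment s f)%E.
  by apply: integral_ge0 => x _; rewrite lee_fin mulr_ge0// powR_ge0.
have mE : (moment s f = (fine (moment s f))%:E)%E by rewrite fineK// ge0_fin_numE.
set m := fine (moment s f) in mE.
set a := Z^-1 * v; have a0 : 0 < a by rewrite mulr_gt0// invr_gt0.
set t := 2 `^ (s - r) : R; have t1 : 1 < t by rewrite powR2_gt1// subr_gt0.
have bound k : (0 < k)%N -> a * t ^+ k <= m.
  move=> k0; rewrite -lee_fin -mE.
  apply: (@le_trans _ _ (\int[mu]_(x in shell k) (enorm x `^ s * f x)%:E)%E); last first.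
    apply: ge0_subset_integral => //; first exact: measurable_shell.
      by apply: measurable_EFin; exact: measurable_funM (measurable_enorm_powR s) mf.
    by move=> x _; rewrite lee_fin mulr_ge0// powR_ge0.
  apply: le_trans (integral_shell_moment_ge mf f0 s0 k0).
  rewrite massE; [|exact: spike_density_is_density|exact: measurable_shell].
  rewrite -EFinM lee_fin /t powRD ?pnatr_eq0 ?implybT// exprMn mulrCA.
  by rewrite ler_wpM2l ?exprn_ge0 ?powR_ge0// spike_density_shell_ge.
(* By Bernoulli's inequality [a * t ^+ n >= a * (1 + n * (t - 1))], which exceeds
   [m] for this [n]. *)
pose n := (Num.truncn (m / (a * (t - 1)))).+1.
have at0 : 0 < a * (t - 1) by rewrite mulr_gt0// subr_gt0.
have := bound n isT; apply/negP; rewrite -ltNge.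
have g1 : 1 - t <= 1 by rewrite gerBl ltW// (lt_trans ltr01).
have := bernoulli_ineq n g1; rewrite subKr => bt.
apply: (@lt_le_trans _ _ (a * (1 - n%:R * (1 - t)))); last by rewrite ler_wpM2l// ltW.
have : m / (a * (t - 1)) < n%:R by exact: truncnS_gt.
rewrite ltr_pdivrMr// => /lt_trans; apply.
by rewrite -subr_gt0 [ltRHS](_ : _ = a)//; ring.
Qed.

End spike_density.

Theorem theorem4 (R : realType) (d j : nat) (alpha : R)
    (d_gt0 : (0 < d)%N) (j_gt0 : (0 < j)%N) (alpha_gt0 : 0 < alpha)
    (alpha_ltd : alpha < d%:R) :
  (forall f : 'rV[R]_d -> R, is_density f ->
     (critical_moment f < (alpha * d%:R / (d%:R - alpha))%:E)%E ->
     (exists k0 : nat, (1 <= k0)%N /\ shell_condition f k0) ->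
     forall (dO : measure_display) (Omega : measurableType dO)
       (P : probability Omega R) (X : nat -> {RV P >-> 'rV[R]_d}),
     iid_with_density X f ->
     limn_esup (fun n => ('E_P[fun w => (n%:R^-1 * S_ X j alpha n w)%R])%E) = +oo%E)
  /\
  (forall r : R, 0 < r -> r < alpha * d%:R / (d%:R - alpha) ->
   exists f : 'rV[R]_d -> R,
     is_density f /\ bounded_fun f /\ continuous f /\
     (exists k0 : nat, (1 <= k0)%N /\ shell_condition f k0) /\
     (I_ (1 - alpha / d%:R) f < +oo)%E /\
     critical_moment f = r%:E /\
     forall (dO : measure_display) (Omega : measurableType dO)
       (P : probability Omega R) (X : nat -> {RV P >-> 'rV[R]_d}),
     iid_with_density X f ->
     limn_esup (fun n => ('E_P[fun w => (n%:R^-1 * S_ X j alpha n w)%R])%E) = +oo%E).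
Proof.
have part1 f : is_density f ->
    (critical_moment f < (alpha * d%:R / (d%:R - alpha))%:E)%E ->
    (exists k0 : nat, (1 <= k0)%N /\ shell_condition f k0) ->
    forall (dO : measure_display) (Omega : measurableType dO)
      (P : probability Omega R) (X : nat -> {RV P >-> 'rV[R]_d}),
    iid_with_density X f ->
    limn_esup (fun n => ('E_P[fun w => (n%:R^-1 * S_ X j alpha n w)%R])%E) =
      +oo%E.
  move=> df rc [k0 [k0_gt0 fk0]] dO Omega P X Xf.
  exact: (limn_esup_expectation_S df alpha_gt0 alpha_ltd rc Xf j_gt0 k0_gt0).
split; first exact: part1.
move=> r r_gt0 r_lt; pose i0 := Ordinal d_gt0; exists (spike_density i0 r).
have df := spike_density_is_density i0 r_gt0.
have rc := spike_density_critical_moment i0 r_gt0.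
have fk0 := spike_density_shell_condition i0 r_gt0.
have rho_gt0 : 0 < 1 - alpha / d%:R.
  by rewrite subr_gt0 ltr_pdivrMr ?ltr0n// mul1r.
split=> //; split; first exact: spike_density_bounded.
split; first exact: spike_density_continuous.
split; first by exists 1%N.
split; first exact: spike_density_I_lty.
split=> // dO Omega P X Xf.
by apply: (part1 _ df _ _ _ _ _ _ Xf); [rewrite rc lte_fin|exists 1%N].
Qed.
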